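(* Let $G$ be a group, and suppose that $G$ has Rubin actions on two topological spaces $X$ and $Y$. Then there exists a $G$-equivariant homeomorphism $X\to Y$.
   Context: Actions of a group on a topological space are by homeomorphisms. For a group $G$ acting on a topological space $X$ and $g\in G$, the support of $g$ is $\operatorname{supp}(g)=\{p\in X \mid g(p)\neq p\}$. For an open set $U\subseteq X$, let $G_U=\{g\in G\mid \operatorname{supp}(g)\subseteq U\}$, a subgroup of $G$. A faithful action of $G$ on $X$ is called a Rubin action if: (1) $X$ is locally compact, Hausdorff, and has no isolated points; and (2) for each open set $U\subseteq X$ and each point $p\in U$, the closure of the orbit of $p$ under $G_U$ contains a neighborhood of $p$. *)

(* Defs.v *)
From HB Require Import structures.
From mathcomp Require Import all_boot.
From mathcomp Require Import all_classical topology.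

Set Implicit Arguments.
Unset Strict Implicit.
Unset Printing Implicit Defensive.

Local Open Scope classical_set_scope.

Definition homeomorphism (X Y : topologicalType) (f : X -> Y) : Prop :=
  exists f' : Y -> X,
    [/\ cancel f f', cancel f' f, continuous f & continuous f'].

(* Unlike the right actions of finite groups in action.v, these are left
   actions, [act (g * h) p = act g (act h p)], of an arbitrary group. *)
Record homeo_action (G : groupType) (X : topologicalType) := HomeoAction {
  act :> G -> X -> X;
  act1 : forall p : X, act 1%g p = p;
  actM : forall (g h : G) (p : X), act (g * h)%g p = act g (act h p);
  act_homeo : forall g : G, homeomorphism (act g)
}.

Section RubinAction.
Context (G : groupType) (X : topologicalType) (a : homeo_action G X).

Definition faithful_action : Prop :=
  forall g : G, (forall p : X, a g p = p) -> g = 1%g.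

(* No closure is taken, so this is an open set when X is Hausdorff. *)
Definition supp (g : G) : set X := [set p | a g p <> p].

Definition supported_in (U : set X) : set G := [set g | supp g `<=` U].

Definition orbit_under (H : set G) (p : X) : set X := [set a g p | g in H].

Record rubin_action : Prop := RubinAction {
  rubin_faithful : faithful_action;
  rubin_locally_compact : locally_compact [set: X];
  rubin_hausdorff : hausdorff_space X;
  rubin_no_isolated : isolated [set: X] = set0;
  rubin_locally_dense : forall (U : set X) (p : X), open U -> U p ->
    nbhs p (closure (orbit_under (supported_in U) p))
}.

End RubinAction.

(* Main.v *)
Require Import Defs.
From HB Require Import structures.
From mathcomp Require Import all_boot.
From mathcomp Require Import all_classical topology.


(** The idea is to recover from the bare group which pairs of elements have
supports that meet, and then to recover the points from this.

Disjointness of supports is almost a group-theoretic property.  Elements with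
disjoint supports are algebraically disjoint ([disjoint_alg_disjoint]), a
condition on commutators only; conversely, if [f] is algebraically disjoint
from [g], then the support of [f] misses that of [g ^+ 12]
([alg_disjoint_supp]).  The twelfth powers do no harm: every nonempty open set
supports an element whose twelfth power is nontrivial ([long_orbit]), so
commuting with all [k ^+ 12], for [k] algebraically disjoint from [g], means
having support in the regular open set [rsupp a g], the interior of the closure
of the support of [g] ([insideP]).  Hence inclusion of a support in a regular
support, and overlap of two supports ([overlapP]), do not depend on the Rubin
action.

In a Rubin action the supports form a basis of the topology.  Given two actions,
on [X] and [Y], call [q] in [Y] a shadow of [p] in [X] when every support around
[p] overlaps every support around [q].  This relation is symmetric and
equivariant.  The density of local orbits gives a group-theoretic consequence
([absorbs]) of the fact that [p] lies in the support of [u], and transporting it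
to [Y] yields two things.  First, some translate of [p] lies in the support of
an element whose support in [Y] has compact closure, so a cluster point exists
and [p] has a shadow ([shadow_exists]).  Secondly, a shadow of a point of the
support of [u] lies in the regular support of [u] ([shadow_rsupp]), so shadows
are unique and depend continuously on the point.  By symmetry, the shadow map
is the required homeomorphism.

This is the approach of Belk, Elliott and Matucci, with points in place of their
ultrafilters. *)

Set Implicit Arguments.
Unset Strict Implicit.
Unset Printing Implicit Defensive.

Local Open Scope group_scope.
Local Open Scope classical_set_scope.

(** * Relations between group elements that mention no action *)

Section AlgebraicRelations.
Context (G : groupType).
Implicit Types f g h k : G.

Definition alg_disjoint f g : Prop :=
  forall h, ~ commute f h ->
  exists f1 f2, [/\ commute f1 g, commute f2 g,
    [~ f1, [~ f2, h]] <> 1 & commute [~ f1, [~ f2, h]] g].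

(** In a Rubin action: the support of [f] lies in the regular support of [g]. *)
Definition inside f g : Prop :=
  forall k, alg_disjoint g k -> commute f (k ^+ 12).

(** In a Rubin action: the supports of [f] and [g] meet. *)
Definition overlap f g : Prop := exists k, [/\ k <> 1, inside k f & inside k g].

Lemma overlapC f g : overlap f g -> overlap g f.
Proof. by case=> k [k1 kf kg]; exists k. Qed.

Lemma commg_mulr f g m :
  commute f m -> commute g m -> [~ f, g^-1 * m] = [~ f, g^-1].
Proof.
move=> fm gm; rewrite !commgEl conjgM; congr (_ * _).
apply/conjg_fixP/commgP.
rewrite /conjg invgK; apply/commute_sym.
by do ![apply: commuteM | apply: commuteV]; exact/commute_sym.
Qed.

End AlgebraicRelations.

(** * Supports of homeomorphisms *)

Lemma closure_sub (T : topologicalType) (A B : set T) :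
  A `<=` closure B -> closure A `<=` closure B.
Proof.
move=> AB; rewrite [closure B](closure_id _).1; last exact: closed_closure.
exact: closureS.
Qed.

Section Support.
Context (G : groupType) (X : topologicalType) (a : homeo_action G X).
Implicit Types (f g h k : G) (p x : X) (U V : set X).

Lemma actK g : cancel (a g) (a g^-1).
Proof. by move=> p; rewrite -actM mulVg act1. Qed.

Lemma actVK g : cancel (a g^-1) (a g).
Proof. by move=> p; rewrite -actM mulgV act1. Qed.

Lemma act_continuous g : continuous (a g).
Proof. by case: (act_homeo a g) => f' []. Qed.

Lemma suppV g : supp a g^-1 = supp a g.
Proof.
apply/seteqP; split=> p /= gp e; apply: gp.
  by rewrite -{1}e actK.
by rewrite -{1}e actVK.
Qed.

Lemma suppM g h : supp a (g * h) `<=` supp a g `|` supp a h.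
Proof.
move=> p /= ghp; apply: contrapT => /not_orP[/contrapT gp /contrapT hp].
by apply: ghp; rewrite actM hp gp.
Qed.

Lemma suppX g n : supp a (g ^+ n) `<=` supp a g.
Proof.
elim: n => [|n IHn] p; first by rewrite /supp /= expg0 act1.
by rewrite expgS => /suppM[|/IHn].
Qed.

Lemma supp_conj g h : supp a (g ^ h) = a h @^-1` supp a g.
Proof.
apply/seteqP; split=> p; rewrite /supp /conjg /= !actM => gp e; apply: gp.
  by rewrite e actK.
by rewrite -{2}e actVK.
Qed.

Lemma act_supported g U p : supp a g `<=` U -> U p -> U (a g p).
Proof.
move=> gU Up; have [->//|gp] := pselect (a g p = p).
by apply: gU => /= /(can_inj (actK g)).
Qed.

Lemma commute_supp g h p : commute g h -> supp a g p -> supp a g (a h p).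
Proof.
by move=> gh gp; rewrite /supp /= -actM gh actM => /(can_inj (actK h)).
Qed.

Lemma commute_actX g h n p : commute g h ->
  a g (a (h ^+ n) p) = a (h ^+ n) (a g p).
Proof. by move=> gh; rewrite -!actM (commuteX n gh). Qed.

Hypothesis fa : faithful_action a.

Lemma act_faithful g h : a g =1 a h -> g = h.
Proof.
move=> gh; apply: (mulgI h^-1); rewrite mulVg; apply: fa => p.
by rewrite actM gh actK.
Qed.

Lemma supp_neq0 g : g <> 1 -> supp a g !=set0.
Proof.
move=> g1; apply: contrapT => g0; apply/g1/fa => p; apply: contrapT => gp.
by apply: g0; exists p.
Qed.

Lemma supp_neq1 g p : supp a g p -> g <> 1.
Proof. by move=> gp g1; apply: gp; rewrite g1 act1. Qed.

Lemma disjoint_commute g h :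
  (forall p, supp a g p -> ~ supp a h p) -> commute g h.
Proof.
move=> gh; apply: act_faithful => p; rewrite !actM.
have [gp|gp] := pselect (a g p = p); last first.
  have hp : a h p = p by apply: contrapT; exact: gh.
  have ggp : supp a g (a g p) by move=> /(can_inj (actK g)).
  by rewrite hp; apply/esym; apply: contrapT; exact: gh ggp.
rewrite gp; apply: contrapT => ghp; case: (gh (a h p) ghp).
by move=> /(can_inj (actK h)) hp; apply: ghp; rewrite !hp.
Qed.

End Support.

(** * Supports in a Rubin action *)

Section RubinAction.
Context (G : groupType) (X : topologicalType) (a : homeo_action G X).
Hypothesis ra : rubin_action a.
Implicit Types (f g h k u v w : G) (p x : X) (U V : set X).

Let fa := rubin_faithful ra.

Lemma separate p q : p <> q ->
  exists U V, [/\ open U, open V, U p, V q & forall x, U x -> ~ V x].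
Proof.
move/eqP => pq; have := rubin_hausdorff ra; rewrite open_hausdorff.
move=> /(_ _ _ pq)[[U V] /= [/set_mem Up /set_mem Vq] [oU oV /eqP UV]].
exists U, V; split=> // x Ux Vx; suff: set0 x by [].
by rewrite -UV.
Qed.

Lemma displace g p U : open U -> U p -> a g p <> p ->
  exists V, [/\ open V, V p, V `<=` U & forall x, V x -> ~ V (a g x)].
Proof.
move=> oU Up /separate[W [V [oW oV Wgp Vp WV]]].
exists (U `&` V `&` a g @^-1` W); split=> //.
- apply: openI; first exact: openI.
  by move/continuousP: (@act_continuous _ _ a g); exact.
- by move=> x [[]].
- by move=> x [_ Wgx] [[_ Vgx] _]; exact: WV Vgx.
Qed.

Lemma displaceX g p U n : open U -> U p ->
  (forall i, 0 < i <= n -> a (g ^+ i) p <> p) ->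
  exists V, [/\ open V, V p, V `<=` U &
    forall i x, 0 < i <= n -> V x -> ~ V (a (g ^+ i) x)].
Proof.
move=> oU Up; elim: n => [|n IHn] gp.
  by exists U; split=> // -[].
have [i /andP[i0 ilen]|V [oV Vp VU Vg]] := IHn.
  by apply: gp; rewrite i0 ltnW.
have gn : a (g ^+ n.+1) p <> p by apply: gp; rewrite /= leqnn.
have [W [oW Wp WV Wg]] := displace oV Vp gn.
exists W; split=> // [x /WV/VU //|i x].
rewrite [i <= _]leq_eqVlt => /andP[i0 /orP[/eqP->|ilen]]; first exact: Wg.
by move=> /WV Vx /WV; apply: Vg => //; rewrite i0.
Qed.

Lemma open_supp g : open (supp a g).
Proof.
rewrite openE => p gp.
have [V [oV Vp _ Vg]] := displace openT I gp.
apply: (filterS _ (open_nbhs_nbhs (conj oV Vp))) => x Vx /= gx.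
by apply: (Vg x) => //; rewrite gx.
Qed.

(** If the local group at [p] fixed [p], then the closure of the orbit would be
{[p]}, and [p] would be isolated.  It follows that the supports form a
basis of the topology. *)
Lemma move_locally U p : open U -> U p ->
  exists2 g, supp a g `<=` U & supp a g p.
Proof.
move=> oU Up; apply: contrapT => nomove.
have orb : orbit_under a (supported_in a U) p `<=` [set p].
  move=> _ [g gU <-] /=; apply: contrapT => gp; apply: nomove.
  by exists g.
have p_isol : isolated [set: X] p; last by rewrite (rubin_no_isolated ra) in p_isol.
split; first exact: in_setT.
exists [set p]; last exact: setIT.
apply: filterS (rubin_locally_dense ra oU Up) => x clx.
apply: contrapT => xp.
have [W [V [oW oV Wx Vp WV]]] := separate xp.
have [_ [/orb -> /WV]] := clx _ (open_nbhs_nbhs (conj oW Wx)).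
exact.
Qed.

Lemma move_open U : open U -> U !=set0 -> exists2 g, supp a g `<=` U & g <> 1.
Proof.
move=> oU [p Up]; have [g gU gp] := move_locally oU Up.
by exists g => //; exact: supp_neq1 gp.
Qed.

(** Induction on [n].  If [h ^+ n.+1] is the identity on a neighborhood [V] of
[p] whose translates by [h], ..., [h ^+ n] avoid [V], then compose [h] with an
element [k] supported in [V] that moves [p]: the orbit of [p] under [h * k]
goes through the translates of [V] and returns to [V] at [a k p] instead
of [p]. *)
Lemma long_orbit n U : open U -> U !=set0 ->
  exists h p, [/\ supp a h `<=` U, U p &
    forall i, 0 < i <= n -> a (h ^+ i) p <> p].
Proof.
move=> oU [p0 Up0]; elim: n => [|n [h [p [hU Up hp]]]].
  have [h hU _] := move_locally oU Up0.
  by exists h, p0; split=> // -[].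
have [V [oV Vp VU Vh]] := displaceX oU Up hp.
have [[x Vx hx]|hV] := pselect (exists2 x, V x & a (h ^+ n.+1) x <> x).
  exists h, x; split=> // [|i]; first exact: VU.
  rewrite [i <= _]leq_eqVlt => /andP[i0 /orP[/eqP->//|ilen]] e.
  by apply: (Vh i x) => //; [rewrite i0 | rewrite e].
have [k kV kp] := move_locally oV Vp.
have Vkp : V (a k p) by exact: act_supported kV Vp.
have hkX i : i <= n -> a ((h * k) ^+ i.+1) p = a (h ^+ i.+1) (a k p).
  elim: i => [|i IHi] ilen; first by rewrite !expg1 actM.
  rewrite expgS actM IHi 1?ltnW// actM [in RHS]expgS actM; congr (a h _).
  apply: contrapT => /kV; apply: Vh => //=.
exists (h * k), p; split=> // [x /suppM[/hU//|/kV/VU//]|[//|i]].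
rewrite ltnS => /= ilen; rewrite hkX //.
move: ilen; rewrite leq_eqVlt => /orP[/eqP->|ilen] e.
  apply: kp; rewrite -[RHS]e; apply/esym; apply: contrapT => hkp; apply: hV.
  by exists (a k p).
by apply: (Vh i.+1 (a k p)) => //; rewrite e.
Qed.

(** As [f] and [h] do not commute, [h] moves a point [p] of the support of [f],
and hence moves a neighborhood [U] off itself.  For [f1] and [f2] supported in
[U], the factor [f2 ^ h] of [[~ f2, h]] has support off [U] and drops out of the
outer commutator.  What is left is [[~ f1, f2^-1]], supported in [U], where [g]
is trivial; it is nontrivial as soon as [f2] moves the support of [f1] off
itself. *)
Lemma disjoint_alg_disjoint f g :
  (forall p, supp a f p -> ~ supp a g p) -> alg_disjoint f g.
Proof.
move=> fg h fh.
have [p fp hp] : exists2 p, supp a f p & supp a h p.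
  apply: contrapT => no; apply/fh/(disjoint_commute fa) => p fp hp.
  by apply: no; exists p.
have [U [oU Up Uf Uh]] := displace (open_supp f) fp hp.
have [f2 f2U f2p] := move_locally oU Up.
have [V [oV Vp VU Vf2]] := displace oU Up f2p.
have [f1 f1V f1p] := move_locally oV Vp.
have commg k : supp a k `<=` U -> commute k g.
  by move=> kU; apply: (disjoint_commute fa) => x /kU/Uf; exact: fg.
have commh k : supp a k `<=` U -> commute k (f2 ^ h).
  move=> kU; apply: (disjoint_commute fa) => x /kU Ux.
  by rewrite supp_conj => /f2U; exact: Uh.
have f1U : supp a f1 `<=` U by move=> x /f1V/VU.
have eqc : [~ f1, [~ f2, h]] = [~ f1, f2^-1].
  by apply: commg_mulr; exact: commh.
exists f1, f2; split; [exact: commg | exact: commg | |]; rewrite eqc.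
  move=> /eqP/commgP/commuteV; rewrite invgK => c.
  by apply: (Vf2 p) => //; apply: f1V; exact: commute_supp.
apply/commute_sym; rewrite commgEl /conjg.
have cg1 := commute_sym (commg _ f1U); have cg2 := commute_sym (commg _ f2U).
by do ![apply: commuteM | apply: commuteV].
Qed.

(** Suppose that [f] and [g ^+ 12] both move [p].  Since 12 is a multiple of 1,
2, 3 and 4, the points [p], ..., [g ^+ 4] [p] are distinct, and some
neighborhood [U] of [p] avoids its first four translates by [g], as well as
its translate by [f].  An [h] supported in [U] that moves [p] does not commute
with [f].  The support of the resulting double commutator [k] is covered by
four translates of [U] by elements commuting with [g], and is invariant under
[g].  Five successive points of a [g]-orbit in it thus contradict the
pigeonhole principle. *)
Lemma alg_disjoint_supp f g p :
  alg_disjoint f g -> supp a f p -> ~ supp a (g ^+ 12) p.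
Proof.
move=> fg fp gp.
have g14 i : 0 < i <= 4 -> a (g ^+ i) p <> p.
  move=> i14 gi; apply: gp.
  (* If g ^+ i fixed p with i dividing 12, then so would g ^+ 12. *)
  have iterX n q : a (g ^+ i) q = q -> a (g ^+ (i * n)) q = q.
    move=> e; elim: n => [|n IHn]; first by rewrite muln0 expg0 act1.
    by rewrite mulnS expgnDr actM IHn.
  have := iterX (12 %/ i) p gi.
  by case: i i14 {gi iterX} => [|[|[|[|[|]]]]].
have [U0 [oU0 U0p _ U0f]] := displace openT I fp.
have [U [oU Up UU0 Ug]] := displaceX oU0 U0p g14.
have [h hU hp] := move_locally oU Up.
have fh : ~ commute f h.
  move=> /commute_sym hf; apply: (U0f p) => //.
  by apply/UU0/hU; exact: commute_supp.
have [f1 [f2 [c1 c2]]] := fg h fh.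
set c := [~ f2, h]; set k := [~ f1, c] => k1 kg.
have cU x : supp a c x -> U (a f2 x) \/ U x.
  rewrite /c commgEr => /suppM[|/hU]; last by right.
  by rewrite supp_conj suppV => /hU; left.
have kU x : supp a k x ->
  exists j : 'I_4, U (a (nth 1 [:: 1; f2; f1; f2 * f1] j) x).
  rewrite /k commgEr => /suppM[|].
    rewrite supp_conj suppV => /cU[]; last by exists (inord 2); rewrite inordK.
    by exists (inord 3); rewrite inordK //= actM.
  move=> /cU[]; first by exists (inord 1); rewrite inordK.
  by exists (inord 0); rewrite inordK //= act1.
have [x kx] := supp_neq0 fa k1.
have kgx (i : 'I_5) : supp a k (a (g ^+ i) x).
  by apply: commute_supp => //; exact: commuteX.
have [j Uj] := choice (fun i => kU _ (kgx i)).
have /injectivePn[i [i' ii' jj]] : ~~ injectiveb j.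
  by apply/negP => /injectiveP/leq_card; rewrite !card_ord.
wlog {ii'} ii' : i i' jj / i < i'.
  move=> wl; move: ii'; rewrite neq_ltn => /orP[|]; first exact: wl.
  by apply: wl.
have := Uj i'; have := Uj i; rewrite -jj.
set s := nth _ _ _.
have sg : commute s g.
  rewrite /s; case: (j i) => -[|[|[|[|//]]]] _ //=.
  - exact/commute_sym/commute1.
  - by apply/commute_sym/commuteM; exact/commute_sym.
rewrite !(commute_actX a _ _ sg) => Ui.
rewrite -(subnK (ltnW ii')) expgnDr actM; apply: Ug => //.
by rewrite subn_gt0 ii' (leq_trans (leq_subr _ _))// -ltnS.
Qed.

(** The regular open set generated by the support. *)
Definition rsupp g : set X := (closure (supp a g))°.

Lemma supp_rsupp g : supp a g `<=` rsupp g.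
Proof.
move=> p gp; apply: filterS (@subset_closure _ _) _.
by apply: open_nbhs_nbhs; split=> //; exact: open_supp.
Qed.

Lemma supp_sub_rsupp f g :
  supp a f `<=` closure (supp a g) -> supp a f `<=` rsupp g.
Proof. by move=> fg; rewrite -open_subsetE //; exact: open_supp. Qed.

Lemma closure_meets U V p : open U -> closure V p -> U p -> exists2 x, V x & U x.
Proof.
move=> oU Vp Up; have [x [Vx Ux]] := Vp _ (open_nbhs_nbhs (conj oU Up)).
by exists x.
Qed.

(** If [f] moves a point outside the closure of the support of [g], it moves a
neighborhood [V] of this point off itself.  An [h] supported in [V] with
[h ^+ 12] nontrivial is algebraically disjoint from [g], yet [h ^+ 12] does not
commute with [f].  For the converse, an open set that misses the support of [g]
also misses its closure. *)
Lemma insideP f g : inside f g <-> supp a f `<=` rsupp g.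
Proof.
split=> [fg|fg k gk].
  apply: supp_sub_rsupp => x fx; apply: contrapT => gx.
  have oO : open (~` closure (supp a g)).
    by apply: closed_openC; exact: closed_closure.
  have [V [oV Vx VO Vf]] := displace oO gx fx.
  have [h [p [hV Vp hp]]] := long_orbit 12 oV (ex_intro _ x Vx).
  have gh : alg_disjoint g h.
    by apply: disjoint_alg_disjoint => y gy /hV/VO; apply; exact: subset_closure.
  have hfp : supp a (h ^+ 12) (a f p).
    apply: commute_supp; last exact: hp.
    exact/commute_sym/fg.
  by apply: (Vf p) => //; exact/hV/(suppX hfp).
apply: (disjoint_commute fa) => p /fg /interior_subset gp kp.
have [x gx kx] := closure_meets (open_supp _) gp kp.
exact: alg_disjoint_supp gk gx kx.
Qed.

Lemma overlapP f g : overlap f g <-> exists2 p, supp a f p & supp a g p.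
Proof.
split=> [[k [k1 /insideP kf /insideP kg]]|[p fp gp]].
  have [p kp] := supp_neq0 fa k1.
  have [x fx kx] := closure_meets (open_supp _) (interior_subset (kf _ kp)) kp.
  have oI := openI (open_supp k) (open_supp f).
  have [y gy [_ fy]] := closure_meets oI (interior_subset (kg _ kx)) (conj kx fx).
  by exists y.
have oI := openI (open_supp f) (open_supp g).
have [k kI k1] := move_open oI (ex_intro _ p (conj fp gp)).
by exists k; split=> //; apply/insideP => x /kI[? ?]; exact: supp_rsupp.
Qed.

Lemma compact_closure_nbhd p U : open U -> U p ->
  exists V, [/\ open V, V p, closure V `<=` U & compact (closure V)].
Proof.
move=> oU Up.
have [K] := @rubin_locally_compact _ _ _ ra p I; rewrite withinET => Kp [cK clK].
have [|W Wp WU] := compact_regular (rubin_hausdorff ra) cK Kp (t := U `&` K).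
  by apply: filterI => //; exact: open_nbhs_nbhs.
have clWU : closure W° `<=` U `&` K.
  by apply: subset_trans WU; apply: closureS; exact: interior_subset.
exists W°; split=> //; first exact: open_interior.
  by apply: subset_trans clWU _; exact: subIsetl.
apply: (subclosed_compact _ cK); first exact: closed_closure.
by apply: subset_trans clWU _; exact: subIsetr.
Qed.

(** A group-theoretic trace of the fact that [p] lies in the support of [u].
Take [v] supported where the orbit of [p] under the elements supported in the
support of [u] is dense: every [w] inside [v] has a support that meets this
orbit. *)
Lemma absorbs p u : supp a u p ->
  exists v, [/\ v <> 1, inside v u &
    forall w, w <> 1 -> inside w v -> exists2 k, inside k u & supp a w (a k p)].
Proof.
move=> up; pose orb := orbit_under a (supported_in a (supp a u)) p.
have oO := openI (open_interior (closure orb)) (open_supp u).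
have [|v vO v1] := move_open oO.
  by exists p; split=> //; exact: (rubin_locally_dense ra (open_supp u) up).
exists v; split=> //; first by apply/insideP => x /vO[_]; exact: supp_rsupp.
move=> w w1 /insideP wv; have [x wx] := supp_neq0 fa w1.
have clx : closure orb x.
  apply: closure_sub (interior_subset (wv _ wx)) => y /vO[].
  by move=> yO _; exact: interior_subset yO.
have [_ [k ku <-] wk] := closure_meets (open_supp w) clx wx.
by exists k => //; apply/insideP => y /ku; exact: supp_rsupp.
Qed.

End RubinAction.

(** * The correspondence between the points of two Rubin actions *)

Section Shadow.
Context (G : groupType) (X Y : topologicalType).
Context (a : homeo_action G X) (b : homeo_action G Y).
Implicit Types (g h k u v w : G) (p : X) (q : Y).

Definition shadow p q : Prop :=
  forall g h, supp a g p -> supp b h q -> overlap g h.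

Hypotheses (ra : rubin_action a) (rb : rubin_action b).

Lemma shadow_closure g p q : shadow p q -> supp a g p -> closure (supp b g) q.
Proof.
move=> pq gp B; rewrite nbhsE => -[U [oU Uq] UB].
have [h hU hq] := move_locally rb oU Uq.
have /(overlapP rb)[y gy hy] := pq _ _ gp hq.
by exists y; split=> //; exact/UB/hU.
Qed.

(** The [v] of [absorbs] is nontrivial in [Y] as well, and its support contains
an open set [V] with closure in it.  Take [w] supported in [V], and [k] inside
[u] such that the support of [w] contains [a k p]; then [b k q] lies in the
closure of the support of [w], hence in the regular support of [u], and [k]
preserves the latter. *)
Lemma shadow_rsupp u p q : shadow p q -> supp a u p -> rsupp b u q.
Proof.
move=> pq up; have [v [v1 /(insideP rb) vu absv]] := absorbs ra up.
have [y vy] := supp_neq0 (rubin_faithful rb) v1.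
have [V [oV Vy Vv _]] := compact_closure_nbhd rb (open_supp rb v) vy.
have [w wV wy] := move_locally rb oV Vy.
have wv : inside w v.
  apply/(insideP rb) => z /wV/subset_closure/Vv; exact: supp_rsupp.
have [k /(insideP rb) ku wkp] := absv w (supp_neq1 wy) wv.
have wkq : closure (supp b (w ^ k)) q.
  by apply: (shadow_closure pq); rewrite supp_conj.
have kq : rsupp b u (b k q).
  apply/vu/Vv => B Bkq.
  have [z []] := wkq _ (@act_continuous _ _ b k q _ Bkq).
  by rewrite supp_conj => /wV Vz Bz; exists (b k z).
rewrite -(actK b k q); apply: act_supported kq.
by rewrite suppV.
Qed.

(** A shadow of [p] is a cluster point of the closures in [Y] of the supports of
the elements that move [p].  These form a filter base, because inclusions of
supports in [X] carry over to [Y] up to closure. *)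
Lemma shadow_exists_precompact p w :
  supp a w p -> compact (closure (supp b w)) -> exists q, shadow p q.
Proof.
move=> wp cw.
pose F := filter_from [set g | supp a g p] (fun g => closure (supp b g)).
have FF : Filter F.
  apply: filter_from_filter; first by exists w.
  move=> g h gp hp.
  have oI := openI (open_supp ra g) (open_supp ra h).
  have [k kI kp] := move_locally ra oI (conj gp hp).
  exists k => // y ky.
  have sub m : supp a k `<=` supp a m -> closure (supp b m) y.
    move=> km; have /(insideP rb) km' : inside k m.
      by apply/(insideP ra) => x /km; exact: supp_rsupp.
    exact: closure_sub (subset_trans km' (@interior_subset _ _)) _ ky.
  by split; apply: sub => x /kI[].
have PF : ProperFilter F.
  apply: filter_from_proper => g gp.
  have [y gy] := supp_neq0 (rubin_faithful rb) (supp_neq1 gp).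
  by exists y; exact: subset_closure.
have [|q [_ Fq]] := cw F PF; first by exists w.
exists q => g h gp hq; apply/(overlapP rb).
have [||y [gy hy]] := Fq (closure (supp b g)) (supp b h).
- by exists g.
- by apply: open_nbhs_nbhs; split=> //; exact: open_supp.
have [z gz hz] := closure_meets (open_supp rb h) gy hy.
by exists z.
Qed.

End Shadow.

Section ShadowMap.
Context (G : groupType) (X Y : topologicalType).
Context (a : homeo_action G X) (b : homeo_action G Y).
Hypotheses (ra : rubin_action a) (rb : rubin_action b).
Implicit Types (g h k u v w : G) (p : X) (q : Y).

Lemma shadowC p q : shadow a b p q -> shadow b a q p.
Proof. by move=> pq g h gq hp; apply/overlapC/pq. Qed.

Lemma shadow_act k p q : shadow a b p q -> shadow a b (a k p) (b k q).
Proof.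
move=> pq g h gkp hkq.
have /(overlapP ra)[x] : overlap (g ^ k) (h ^ k) by apply: pq; rewrite supp_conj.
rewrite !supp_conj => gx hx.
by apply/(overlapP ra); exists (a k x).
Qed.

(** No support around [p] itself is known to be relatively compact in [Y], but
[absorbs] moves [p] into the support of some [w] that has this property, and
shadows are equivariant. *)
Lemma shadow_exists p : exists q, shadow a b p q.
Proof.
have [u _ up] := move_locally ra openT (I : setT p).
have [v [v1 _ absv]] := absorbs ra up.
have [y vy] := supp_neq0 (rubin_faithful rb) v1.
have [V [oV Vy Vv cV]] := compact_closure_nbhd rb (open_supp rb v) vy.
have [w wV wy] := move_locally rb oV Vy.
have [|k _ wkp] := absv w (supp_neq1 wy).
  by apply/(insideP rb) => z /wV/subset_closure/Vv; exact: supp_rsupp.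
have [|q kpq] := shadow_exists_precompact ra rb wkp.
  apply: (subclosed_compact _ cV); first exact: closed_closure.
  exact: closureS.
by exists (b k^-1 q); rewrite -(actK a k p); exact: shadow_act.
Qed.

(** Two distinct shadows would lie in disjoint supports of some [u] and [v].
Then [p] would lie in the regular supports of both in [X], so that [u] and [v]
would overlap. *)
Lemma shadow_unique p q q' : shadow a b p q -> shadow a b p q' -> q = q'.
Proof.
move=> pq pq'; apply: contrapT => /(separate rb)[U [V [oU oV Uq Vq' UV]]].
have [u uU uq] := move_locally rb oU Uq.
have [v vV vq'] := move_locally rb oV Vq'.
have pu := shadow_rsupp rb ra (shadowC pq) uq.
have pv := interior_subset (shadow_rsupp rb ra (shadowC pq') vq').
have [x vx ux] := closure_meets (open_interior _) pv pu.
have [y uy vy] := closure_meets (open_supp ra v) (interior_subset ux) vx.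
have /(overlapP rb)[z /uU Uz /vV Vz] : overlap u v.
  by apply/(overlapP ra); exists y.
exact: UV Uz Vz.
Qed.

(** If [f p] lies in the support of [u], then [f] maps the regular support of [u]
in [X], a neighborhood of [p], into the closure of the support of [u] in [Y],
which is as close to [f p] as desired since [Y] is regular. *)
Lemma shadow_continuous (f : X -> Y) :
  (forall p, shadow a b p (f p)) -> continuous f.
Proof.
move=> fs p B; rewrite nbhsE => -[U [oU Ufp] UB].
have [V [oV Vfp VU _]] := compact_closure_nbhd rb oU Ufp.
have [u uV ufp] := move_locally rb oV Vfp.
have pu := shadow_rsupp rb ra (shadowC (fs p)) ufp.
apply: filterS (open_nbhs_nbhs (conj (open_interior _) pu)) => x xu /=.
apply/UB/VU; apply: closureS uV _ _.
have [k ku kx] := move_locally ra (open_interior _) xu.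
have /(insideP rb) ku' : inside k u by apply/(insideP ra).
have kfx := shadow_closure rb (fs x) kx.
exact: closure_sub (subset_trans ku' (@interior_subset _ _)) _ kfx.
Qed.

End ShadowMap.

Theorem mainTheorem1 (G : groupType) (X Y : topologicalType)
    (a : homeo_action G X) (b : homeo_action G Y) :
  rubin_action a -> rubin_action b ->
  exists f : X -> Y,
    homeomorphism f /\ forall (g : G) (p : X), f (a g p) = b g (f p).
Proof.
move=> ra rb.
have [f fs] := choice (shadow_exists ra rb).
have [f' fs'] := choice (shadow_exists rb ra).
exists f; split; last first.
  by move=> g p; apply: (shadow_unique ra rb (fs _)); exact: shadow_act.
exists f'; split.
- by move=> p; apply: (shadow_unique rb ra (fs' _)); exact: shadowC.
- by move=> q; apply: (shadow_unique ra rb (fs _)); exact: shadowC.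
- exact: shadow_continuous fs.
- exact: shadow_continuous fs'.
Qed.
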